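(* Let $p \geq 5$ be a prime and let $a, b$ be nonnegative integers. Then \[ \binom{ap}{bp}_q \equiv \binom{a}{b}_{q^{p^2}} - \binom{a}{b+1}\binom{b+1}{2}\frac{p^2-1}{12}(q^p-1)^2 \pmod{[p]_q^3}, \] where the congruence is understood in the ring $\mathbb{Z}[q]$ of polynomials in $q$ with integer coefficients (i.e. the difference of the two sides is $[p]_q^3$ times a polynomial in $\mathbb{Z}[q]$).
   Context: For a nonnegative integer $n$, $[n]_q := 1 + q + \cdots + q^{n-1}$ (so $[0]_q=0$), $[n]_q! := [n]_q [n-1]_q \cdots [1]_q$ (with $[0]_q! = 1$), and for integers $0 \le k \le n$ the $q$-binomial coefficient is $\binom{n}{k}_q := \frac{[n]_q!}{[k]_q!\,[n-k]_q!}$, which is a polynomial in $q$ with nonnegative integer coefficients; $\binom{n}{k}_q := 0$ if $k > n$. The notation $\binom{a}{b}_{q^{p^2}}$ means the $q$-binomial coefficient with $q$ replaced by $q^{p^2}$. The symbols $\binom{a}{b+1}$ and $\binom{b+1}{2}$ are ordinary binomial coefficients. Note $12$ divides $p^2-1$ for primes $p \ge 5$. *)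

(* Defs.v *)
From HB Require Import structures.
From mathcomp Require Import all_boot all_order all_algebra.
From mathcomp Require Import zify ring.

Set Implicit Arguments.
Unset Strict Implicit.
Unset Printing Implicit Defensive.

Import Order.TTheory GRing.Theory Num.Theory.

Local Open Scope ring_scope.

Definition qint (n : nat) : {poly int} := \sum_(i < n) 'X^i.

Definition qfact (n : nat) : {poly int} := \prod_(1 <= i < n.+1) qint i.

(* The denominator is monic, so [%/] is Euclidean division over the integers;
   it is exact by [qbinomE] below. *)
Definition qbinom (n k : nat) : {poly int} :=
  if (k <= n)%N then qfact n %/ (qfact k * qfact (n - k)) else 0.

Lemma qfact0 : qfact 0 = 1.
Proof. by rewrite /qfact big_geq. Qed.

Lemma qfactS n : qfact n.+1 = qint n.+1 * qfact n.
Proof. by rewrite /qfact big_nat_recr //= mulrC. Qed.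

Lemma qintD m n : qint (m + n) = qint m + 'X^m * qint n.
Proof.
rewrite /qint big_split_ord /= mulr_sumr; congr (_ + _).
by apply: eq_bigr => i _; rewrite exprD.
Qed.

Lemma qint_monic n : qint n.+1 \is monic.
Proof.
rewrite /qint; have -> : \sum_(i < n.+1) 'X^i = \poly_(i < n.+1) (1 : int).
  by rewrite poly_def; apply: eq_bigr => i _; rewrite scale1r.
by rewrite monicE lead_coef_poly // oner_eq0.
Qed.

Lemma qfact_monic n : qfact n \is monic.
Proof.
elim: n => [|n IHn]; first by rewrite qfact0 monic1.
by rewrite qfactS monicMl ?qint_monic.
Qed.

Lemma qfact_dvd m n :
  exists c : {poly int}, qfact (m + n) = c * (qfact m * qfact n).
Proof.
have [s] := ubnP (m + n); elim: s m n => // s IHs [|m] [|n] Hs.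
- by exists 1; rewrite qfact0 !mul1r.
- by exists 1; rewrite qfact0 !mul1r.
- by exists 1; rewrite addn0 qfact0 mulr1 mul1r.
have [|c1 e1] := IHs m n.+1; first by lia.
have [|c2 e2] := IHs m.+1 n; first by lia.
exists (c1 + 'X^(m.+1) * c2).
rewrite addSn qfactS -addSn qintD mulrDl -mulrA -{2}addSnnS e2 e1 !qfactS.
by ring.
Qed.

Lemma qbinomE n k : (k <= n)%N ->
  qbinom n k * (qfact k * qfact (n - k)) = qfact n.
Proof.
move=> le_kn; have [c] := qfact_dvd k (n - k); rewrite subnKC // => e.
by rewrite /qbinom le_kn e Pdiv.IdomainMonic.mulpK ?monicMl ?qfact_monic.
Qed.

(* Main.v *)
(* Splitting (a+1)p = ap + p in the q-Vandermonde identity gives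
     binom((a+1)p, k) = sum_j q^(j(ap+j-k)) binom(ap, k-j) binom(p, j),
   where binom(p, j) is divisible by [p] for 0 < j < p. The terms j = 0 and
   j = p reproduce the q-Pascal rule in base q^(p^2). For k = (b+1)p each other
   term has two factors divisible by [p], so modulo [p]^3 it suffices to know
     binom(ap, bp+k) == (b+1) C(a, b+1) binom(p, k)   mod [p]^2,  0 < k < p,
   and the theorem reduces to its first nontrivial case
     sum_(0<i<p) q^(i^2) binom(p, i)^2 == -(p^2-1)/12 (q^p-1)^2   mod [p]^3.
   After division by [p]^2 this is checked at the primitive p-th roots of unity
   z, where it reads  sum_(0<i<p) z^i / (1-z^i)^2 = -(p^2-1)/12. *)
Require Import Defs.
From HB Require Import structures.
From mathcomp Require Import all_boot all_order all_algebra all_field.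
From mathcomp Require Import zify ring.
Import GRing.Theory Num.Theory.
Local Open Scope ring_scope.

Set Implicit Arguments.
Unset Strict Implicit.
Unset Printing Implicit Defensive.

(** * Identities for q-binomials: absorption, Pascal, Vandermonde *)

Lemma qint0 : qint 0 = 0.
Proof. by rewrite /qint big_ord0. Qed.

Lemma qintS_neq0 n : qint n.+1 != 0.
Proof. exact/monic_neq0/qint_monic. Qed.

Lemma qfact_neq0 n : qfact n != 0.
Proof. exact/monic_neq0/qfact_monic. Qed.

Lemma subX1_qint n : ('X - 1) * qint n = 'X^n - 1.
Proof. by rewrite subrX1 /qint. Qed.

Lemma qbinom_small n k : (n < k)%N -> qbinom n k = 0.
Proof. by rewrite /qbinom ltnNge => /negbTE->. Qed.

Lemma qbinomn0 n : qbinom n 0 = 1.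
Proof.
apply: (mulIf (qfact_neq0 n)); have := qbinomE (leq0n n).
by rewrite qfact0 mul1r subn0 mul1r.
Qed.

Lemma qbinomnn n : qbinom n n = 1.
Proof.
apply: (mulIf (qfact_neq0 n)); have := qbinomE (leqnn n).
by rewrite subnn qfact0 mulr1 mul1r.
Qed.

Lemma qbinom_sub n k : (k <= n)%N -> qbinom n (n - k) = qbinom n k.
Proof.
move=> le_kn.
apply: (mulIf (mulf_neq0 (qfact_neq0 k) (qfact_neq0 (n - k)))).
rewrite qbinomE // [qfact k * _]mulrC.
by have := qbinomE (leq_subr k n); rewrite subKn.
Qed.

Lemma qbinom_absorb n k :
  qint k.+1 * qbinom n.+1 k.+1 = qint n.+1 * qbinom n k.
Proof.
have [lt_nk|le_kn] := ltnP n k.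
  by rewrite !qbinom_small // !mulr0.
apply: (mulIf (mulf_neq0 (qfact_neq0 k) (qfact_neq0 (n - k)))).
rewrite -[RHS]mulrA qbinomE // -qfactS.
have := @qbinomE n.+1 k.+1 le_kn; rewrite subSS qfactS => <-.
by ring.
Qed.

Lemma qbinom_absorb_right n k :
  qint k.+1 * qbinom n k.+1 = qint (n - k) * qbinom n k.
Proof.
have [le_nk|lt_kn] := leqP n k.
  have /eqP-> : (n - k == 0)%N by rewrite subn_eq0.
  by rewrite qbinom_small ?ltnS // qint0 mulr0 mul0r.
apply: (mulIf (mulf_neq0 (qfact_neq0 k) (qfact_neq0 (n - k.+1)))).
have e1 := qbinomE lt_kn; have e2 := qbinomE (ltnW lt_kn).
rewrite qfactS in e1.
have e3 : qfact (n - k) = qint (n - k) * qfact (n - k.+1).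
  by rewrite -(subnSK lt_kn) qfactS.
rewrite e3 in e2; transitivity (qfact n); first by rewrite -e1; ring.
by rewrite -e2; ring.
Qed.

Lemma qbinomS n k :
  qbinom n.+1 k.+1 = qbinom n k.+1 + 'X^(n - k) * qbinom n k.
Proof.
have [lt_nk|le_kn] := ltnP n k.
  by rewrite !qbinom_small ?mulr0 ?addr0 // ltnW.
apply: (mulfI (qintS_neq0 k)); rewrite mulrDr qbinom_absorb.
rewrite qbinom_absorb_right -{1}(subnK le_kn) -addnS qintD; ring.
Qed.

(** Induction on [n], with the Pascal rule applied to [m + n] on the left and to [n] inside the sum.
    The guard [j <= k] removes terms where the truncated [k - j] would be 0 and bring in a spurious
    [qbinom m 0 = 1]. *)
Lemma qVandermonde m n k :
  qbinom (m + n) k =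
    \sum_(0 <= j < n.+1 | (j <= k)%N)
      'X^(j * (m + j - k)) * qbinom m (k - j) * qbinom n j.
Proof.
elim: n k => [|n IHn] k.
  by rewrite addn0 big_mkcond big_nat1 /= mul0n expr0 subn0 qbinomn0 mul1r mulr1.
case: k => [|k].
  rewrite qbinomn0 big_mkcond big_nat_recl //= big1 ?addr0.
    by rewrite mul0n expr0 !qbinomn0 !mulr1.
  by [].
rewrite addnS qbinomS !IHn big_mkcond [RHS]big_mkcond /=.
rewrite [RHS]big_nat_recl //= [X in X + _ = _]big_nat_recl //=.
rewrite !qbinomn0 -addrA; congr (_ + _).
transitivity (\sum_(0 <= i < n.+1)
    (if (i < k.+1)%N then 'X^(i.+1 * (m + i.+1 - k.+1)) * qbinom m (k.+1 - i.+1) *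
      qbinom n i.+1 else 0) +
   'X^(m + n - k) *
   \sum_(0 <= j < n.+1 | (j <= k)%N) 'X^(j * (m + j - k)) * qbinom m (k - j) * qbinom n j).
  congr (_ + _); rewrite [RHS]big_nat_recr //= (@qbinom_small n n.+1) //.
  by rewrite mulr0 if_same addr0.
rewrite [X in _ + _ * X = _]big_mkcond mulr_sumr -big_split /=.
rewrite !big_nat; apply: eq_bigr => j /andP[_ lt_jn].
rewrite ltnS; case: ifP => le_jk; last by rewrite mulr0 addr0.
rewrite subSS addnS subSS qbinomS mulrDr; congr (_ + _).
(* The exponents are compared only when [m + j - k] is a true difference; otherwise the factor
   [qbinom m (k - j)] is zero. *)
have [lt_mk|le_km] := ltnP m (k - j).
  by rewrite (qbinom_small lt_mk) !(mulr0, mul0r).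
have -> : 'X^(j.+1 * (m + j - k)) * qbinom m (k - j) * ('X^(n - j) * qbinom n j)
  = ('X^(j.+1 * (m + j - k)) * 'X^(n - j)) * (qbinom m (k - j) * qbinom n j)
   :> {poly int} by ring.
rewrite -exprD -!mulrA mulrA -exprD; congr ('X^_ * _).
rewrite mulSn; lia.
Qed.

(** * Divisibility by powers of [qint p] over the integers *)

Definition qdvd (p e : nat) (f : {poly int}) := exists h, f = qint p ^+ e * h.

Section Divisibility.
Variable p : nat.
Implicit Types (e : nat) (f g : {poly int}).

Lemma qdvd0 e : qdvd p e 0.
Proof. by exists 0; rewrite mulr0. Qed.

Lemma qdvdD e f g : qdvd p e f -> qdvd p e g -> qdvd p e (f + g).
Proof. by move=> [h ->] [h' ->]; exists (h + h'); rewrite mulrDr. Qed.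

Lemma qdvdN e f : qdvd p e f -> qdvd p e (- f).
Proof. by move=> [h ->]; exists (- h); rewrite mulrN. Qed.

Lemma qdvdM e e' f g : qdvd p e f -> qdvd p e' g -> qdvd p (e + e') (f * g).
Proof.
by move=> [h ->] [h' ->]; exists (h * h'); rewrite exprD; ring.
Qed.

Lemma qdvdMl e f g : qdvd p e g -> qdvd p e (f * g).
Proof. by move=> [h ->]; exists (f * h); ring. Qed.

Lemma qdvdMr e f g : qdvd p e f -> qdvd p e (f * g).
Proof. by rewrite mulrC; apply: qdvdMl. Qed.

Lemma qdvd_sum (I : Type) (r : seq I) (P : pred I) e (F : I -> {poly int}) :
  (forall i, P i -> qdvd p e (F i)) -> qdvd p e (\sum_(i <- r | P i) F i).
Proof. by move=> H; elim/big_ind: _ => //; [apply: qdvd0 | apply: qdvdD]. Qed.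

Lemma qdvd_Xp : qdvd p 1 ('X^p - 1).
Proof. by exists ('X - 1); rewrite -subX1_qint mulrC. Qed.

Lemma qdvd_Xpm m : qdvd p 1 ('X^(p * m) - 1).
Proof. by rewrite exprM subrX1; apply/qdvdMr/qdvd_Xp. Qed.

End Divisibility.

(** * Evaluation at [p]-th roots of unity, and sums over them *)

Definition eval_at (z : algC) (f : {poly int}) : algC := (map_poly intr f).[z].

HB.instance Definition _ z :=
  GRing.RMorphism.copy (eval_at z) (horner_eval z \o map_poly intr).

Lemma eval_atX z : eval_at z 'X = z.
Proof. by rewrite /eval_at map_polyX hornerX. Qed.

Lemma eval_atXn z n : eval_at z 'X^n = z ^+ n.
Proof. by rewrite rmorphXn /= eval_atX. Qed.

Lemma eval_qint z n : (z - 1) * eval_at z (qint n) = z ^+ n - 1.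
Proof.
rewrite -eval_atXn -(rmorph1 (eval_at z)) -{1}(eval_atX z).
by rewrite -!rmorphB -rmorphM subX1_qint.
Qed.

Section RootOfUnity.
Variables (p : nat) (p_prime : prime p).
Implicit Types z w : algC.

Lemma prime_prim_neq1 z : p.-primitive_root z -> z != 1.
Proof.
move=> pz; rewrite -(expr1 z) -(prim_order_dvd pz) dvdn1.
by rewrite neq_ltn prime_gt1 ?orbT.
Qed.

Lemma eval_qint_eq0 z n :
  p.-primitive_root z -> (eval_at z (qint n) == 0) = (p %| n)%N.
Proof.
move=> pz; rewrite (prim_order_dvd pz) -[RHS]subr_eq0 -eval_qint mulf_eq0.
by rewrite subr_eq0 (negbTE (prime_prim_neq1 pz)).
Qed.

(** The remainder of [f] modulo the monic [qint p] has degree below [p - 1], yet it vanishes at the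
    [p - 1] distinct numbers [z0 ^+ i], [0 < i < p]; hence it is 0. *)
Lemma qdvd_eval f :
  (forall z, p.-primitive_root z -> eval_at z f = 0) -> qdvd p 1 f.
Proof.
move=> f0; have p_gt0 := prime_gt0 p_prime.
have mon : qint p \is monic by rewrite -(prednK p_gt0) qint_monic.
have fE := Pdiv.IdomainMonic.divp_eq mon f.
set r := f %% qint p in fE.
have r0 z : p.-primitive_root z -> eval_at z r = 0.
  move=> pz; have := f0 z pz; rewrite fE rmorphD rmorphM /=.
  have /eqP-> : eval_at z (qint p) == 0 by rewrite eval_qint_eq0.
  by rewrite mulr0 add0r.
have szq : size (qint p) = p.
  rewrite /qint; have -> : \sum_(i < p) 'X^i = \poly_(i < p) (1 : int).
    by rewrite poly_def; apply: eq_bigr => i _; rewrite scale1r.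
  by rewrite size_poly_eq // oner_eq0.
have szr : (size r < p)%N.
  by rewrite -[X in (_ < X)%N]szq ltn_modp monic_neq0.
have [z0 pz0] := C_prim_root_exists p_gt0.
suff -> : f = qint p * (f %/ qint p) by exists (f %/ qint p); rewrite expr1.
suff r_eq0 : r = 0 by rewrite {1}fE r_eq0 addr0 mulrC.
apply/eqP; apply: contraTT szr => r_neq0; rewrite -leqNgt.
have szm : size (map_poly (intr : int -> algC) r) = size r.
  by apply: size_map_inj_poly => //; apply: intr_inj.
have mr_neq0 : map_poly (intr : int -> algC) r != 0.
  by rewrite -size_poly_eq0 szm size_poly_eq0.
have := @max_poly_roots _ _ [seq z0 ^+ i | i <- iota 1 p.-1] mr_neq0.
rewrite size_map size_iota szm prednK //; apply.
  apply/allP => x /mapP[i]; rewrite mem_iota => /andP[i_gt0 lt_ip] ->.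
  apply/rootP/r0; rewrite prim_root_exp_coprime // coprime_sym.
  by rewrite prime_coprime // gtnNdvd // -ltnS; lia.
rewrite map_inj_in_uniq ?iota_uniq // => i j.
rewrite !mem_iota => Hi Hj /eqP; rewrite (eq_prim_root_expr pz0).
by rewrite !modn_small => [/eqP||]; lia.
Qed.

(** By absorption [[m] binom(ap, m) = [ap] binom(ap-1, m-1)]; at a primitive [p]-th root of unity
    [[ap]] vanishes and [[m]] does not. *)
Lemma qdvd_qbinom_mul a m : ~~ (p %| m)%N -> qdvd p 1 (qbinom (a * p) m).
Proof.
move=> ndvd; have p_gt0 := prime_gt0 p_prime.
case: m ndvd => [|m] ndvd; first by rewrite dvdn0 in ndvd.
case: a => [|a]; first by rewrite qbinom_small //; apply: qdvd0.
apply: qdvd_eval => z pz; apply/eqP.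
have := congr1 (eval_at z) (qbinom_absorb (a.+1 * p).-1 m).
rewrite prednK ?muln_gt0 ?p_gt0 // !rmorphM /=.
have /eqP-> : eval_at z (qint (a.+1 * p)) == 0.
  by rewrite eval_qint_eq0 ?dvdn_mull.
by move/eqP; rewrite mul0r mulf_eq0 eval_qint_eq0 // (negbTE ndvd).
Qed.

Lemma qdvd_qbinom m : (0 < m < p)%N -> qdvd p 1 (qbinom p m).
Proof.
by move=> /andP[m0 mp]; rewrite -{2}(mul1n p); apply: qdvd_qbinom_mul; rewrite gtnNdvd.
Qed.

(* The sequence k(p - k) has constant second difference -2, except at k = 0
   when it is extended p-periodically. *)
Lemma sum_root_unity w : w ^+ p = 1 -> w != 1 ->
  (1 - w) ^+ 2 * \sum_(0 <= k < p) (k%:R * (p%:R - k%:R)) * w ^+ k = 2 * p%:R * w.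
Proof.
move=> wp1 w1; have w1' : 1 - w != 0 by rewrite subr_eq0 eq_sym.
(* [A] is the constant that makes the closed form of the partial sums vanish at [n = 0]. At [n = p],
   where [w ^+ p = 1], the terms in [p^2] cancel and [2 p w (1 - w)] remains. *)
pose A := w * (1 + w) - p%:R * w * (1 - w).
have partial n :
  (1 - w) ^+ 3 * \sum_(0 <= k < n) (k%:R * (p%:R - k%:R)) * w ^+ k =
  w ^+ n * ((1 - w) ^+ 2 * n%:R ^+ 2 +
            (1 - w) * (2 * w - p%:R * (1 - w)) * n%:R + A) - A.
  elim: n => [|n IHn].
    by rewrite big_geq // mulr0 expr0 /A; ring.
  rewrite big_nat_recr //= mulrDr IHn -[n.+1%:R]natr1 [w ^+ n.+1]exprS /A.
  set x := w ^+ n; ring.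
apply: (mulfI w1'); rewrite mulrA -exprS partial wp1; ring.
Qed.

(** The full geometric sum of the nontrivial root of unity [z ^+ k] is 0; dropping its term [i = 0]
    leaves -1. *)
Lemma sum_powers_prim z k : p.-primitive_root z -> (0 < k < p)%N ->
  \sum_(1 <= i < p) (z ^+ i) ^+ k = -1.
Proof.
move=> pz /andP[k_gt0 lt_kp].
have zk1 : z ^+ k != 1 by rewrite -(prim_order_dvd pz) gtnNdvd.
have H : \sum_(0 <= i < p) (z ^+ k) ^+ i = 0.
  have := subrX1 (z ^+ k) p; rewrite exprAC (prim_expr_order pz).
  rewrite expr1n subrr => /esym/eqP; rewrite mulf_eq0 subr_eq0 (negbTE zk1) /=.
  by rewrite big_mkord => /eqP.
move: H; rewrite big_ltn ?prime_gt0 // expr0 => /eqP.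
rewrite addrC addr_eq0 => /eqP <-; apply: eq_bigr => i _.
by rewrite -!exprM mulnC.
Qed.

(** The bound [n] is kept apart from [p] so that induction applies; at [n = p] the right side is
    [p (p^2 - 1)]. *)
Lemma sum_natM_sub n :
  6 * \sum_(0 <= k < n) (k%:R * (p%:R - k%:R)) =
    3 * p%:R * n%:R * (n%:R - 1) - (n%:R - 1) * n%:R * (2 * n%:R - 1) :> algC.
Proof.
elim: n => [|n IHn]; first by rewrite big_geq //; ring.
by rewrite big_nat_recr //= mulrDr IHn -natr1; ring.
Qed.

(** By [sum_root_unity], each [w / (1 - w)^2] is a combination of powers [w ^+ k] with coefficients
    [k (p - k) / (2p)]. After exchanging the sums, the power sums are -1 and only the sum of
    [k (p - k)] is left. *)
Lemma sum_prim_inverse_square z : p.-primitive_root z ->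
  12 * \sum_(1 <= i < p) z ^+ i / (1 - z ^+ i) ^+ 2 = 1 - p%:R ^+ 2.
Proof.
move=> pz; have p0 : p%:R != 0 :> algC.
  by rewrite pnatr_eq0 -lt0n prime_gt0.
have two0 : 2 != 0 :> algC by rewrite pnatr_eq0.
have -> : \sum_(1 <= i < p) z ^+ i / (1 - z ^+ i) ^+ 2 =
   (2 * p%:R)^-1 * \sum_(0 <= k < p)
     k%:R * (p%:R - k%:R) * \sum_(1 <= i < p) (z ^+ i) ^+ k.
  under [in RHS]eq_bigr => k _ do rewrite mulr_sumr.
  rewrite exchange_big mulr_sumr /=.
  rewrite !big_nat; apply: eq_bigr => i /andP[i0 ip].
  have zi1 : z ^+ i != 1 by rewrite -(prim_order_dvd pz) gtnNdvd.
  have zp : (z ^+ i) ^+ p = 1 by rewrite exprAC (prim_expr_order pz) expr1n.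
  have d0 : 1 - z ^+ i != 0 by rewrite subr_eq0 eq_sym.
  have E := sum_root_unity zp zi1.
  apply: (mulfI (mulf_neq0 two0 p0)); rewrite !mulrA divff ?mulf_neq0 // mul1r.
  by rewrite -E mulrC mulrA mulVf ?expf_neq0 // mul1r.
have -> : \sum_(0 <= k < p) k%:R * (p%:R - k%:R) * \sum_(1 <= i < p) (z ^+ i) ^+ k
  = - \sum_(0 <= k < p) (k%:R * (p%:R - k%:R)) :> algC.
  rewrite -sumrN !big_nat; apply: eq_bigr => k /andP[_ lt_kp].
  (* At [k = 0] the inner sum is [p - 1] rather than -1, but its coefficient is zero. *)
  case: k lt_kp => [|k] lt_kp; first by rewrite !mul0r oppr0.
  by rewrite sum_powers_prim // mulrN1.
have E := sum_natM_sub p.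
apply: (mulfI p0); transitivity (- (6 * \sum_(0 <= k < p) (k%:R * (p%:R - k%:R))) : algC).
  by field; rewrite p0.
by rewrite E; ring.
Qed.

(** * The first nontrivial case: the sum of squares *)

(** At [z], [[p] = 0] gives [[p-1-j] = -z^(p-1-j) [j+1]], so passing from [j] to [j + 1] multiplies
    the q-binomial by [-z^(p-1-j)]. Squaring removes the sign. *)
Lemma eval_qbinom_pred z j : p.-primitive_root z -> (j < p)%N ->
  eval_at z (qbinom p.-1 j) ^+ 2 * z ^+ (j * j.+1) = 1.
Proof.
move=> pz; elim: j => [|j IHj] lt_jp.
  by rewrite qbinomn0 rmorph1 expr1n mul0n expr0 mulr1.
have := congr1 (eval_at z) (qbinom_absorb_right p.-1 j).
rewrite !rmorphM /=.
have j0 : eval_at z (qint j.+1) != 0 by rewrite eval_qint_eq0 // gtnNdvd.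
have E : eval_at z (qint (p.-1 - j)) = - (z ^+ (p.-1 - j) * eval_at z (qint j.+1)).
  apply/eqP; rewrite -addr_eq0 -eval_atXn -rmorphM -rmorphD -qintD.
  have -> : (p.-1 - j + j.+1)%N = p by lia.
  by rewrite eval_qint_eq0.
rewrite E => E1; have {}E1 : eval_at z (qbinom p.-1 j.+1) =
   - z ^+ (p.-1 - j) * eval_at z (qbinom p.-1 j).
  by apply: (mulfI j0); rewrite E1; ring.
rewrite E1 exprMn sqrrN.
have -> : (z ^+ (p.-1 - j)) ^+ 2 * eval_at z (qbinom p.-1 j) ^+ 2 * z ^+ (j.+1 * j.+2)
 = eval_at z (qbinom p.-1 j) ^+ 2 * ((z ^+ (p.-1 - j)) ^+ 2 * z ^+ (j.+1 * j.+2)).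
  by ring.
rewrite -exprM -exprD.
have -> : ((p.-1 - j) * 2 + j.+1 * j.+2 = p * 2 + j * j.+1)%N.
  by lia.
rewrite exprD exprM (prim_expr_order pz) expr1n mul1r; apply: IHj; exact: ltnW.
Qed.

(** Both summands contain [[p]^2], through [binom(p, i) = [p] B i] and [q^p - 1 = (q - 1)[p]]. At
    [z] the cofactor is computed by [sum_prim_inverse_square]. *)
Lemma qdvd_sum_sqr_qbinom N : (12 * N)%N = (p ^ 2 - 1)%N ->
  qdvd p 3 (\sum_(1 <= i < p) 'X^(i ^ 2) * qbinom p i ^+ 2
            + N%:R * ('X^p - 1) ^+ 2).
Proof.
move=> NE; have p_gt0 := prime_gt0 p_prime.
have mon : qint p \is monic by rewrite -(prednK p_gt0) qint_monic.
pose B i := qbinom p i %/ qint p.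
have BE i : (0 < i < p)%N -> qbinom p i = qint p * B i.
  move=> /qdvd_qbinom[h]; rewrite /B expr1 => ->.
  by rewrite Pdiv.IdomainMonic.mulKp.
have BI i : (0 < i < p)%N -> qint i * B i = qbinom p.-1 i.-1.
  move=> Hi; apply: (mulfI (monic_neq0 mon)).
  have := qbinom_absorb p.-1 i.-1; rewrite !prednK //; last by case/andP: Hi.
  by move=> <-; rewrite (BE i Hi); ring.
have -> : \sum_(1 <= i < p) 'X^(i ^ 2) * qbinom p i ^+ 2
            + N%:R * ('X^p - 1) ^+ 2 =
  qint p ^+ 2 * (\sum_(1 <= i < p) 'X^(i ^ 2) * B i ^+ 2 + N%:R * ('X - 1) ^+ 2).
  rewrite mulrDr mulr_sumr -subX1_qint; congr (_ + _); last by ring.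
  by rewrite !big_nat; apply: eq_bigr => i Hi; rewrite (BE i Hi); ring.
apply: (@qdvdM p 2 1); first by exists 1; rewrite mulr1.
apply: qdvd_eval => z pz.
rewrite rmorphD rmorphM rmorph_nat rmorphXn rmorphB /= eval_atX rmorph1 rmorph_sum /=.
have -> : \sum_(1 <= i < p) eval_at z ('X^(i ^ 2) * B i ^+ 2) =
   (1 - z) ^+ 2 * \sum_(1 <= i < p) z ^+ i / (1 - z ^+ i) ^+ 2.
  rewrite mulr_sumr !big_nat; apply: eq_bigr => i Hi; case/andP: (Hi) => i0 ip.
  have zi1 : z ^+ i != 1 by rewrite -(prim_order_dvd pz) gtnNdvd.
  have d0 : 1 - z ^+ i != 0 by rewrite subr_eq0 eq_sym.
  have E1 := eval_qbinom_pred pz (leq_ltn_trans (leq_pred i) ip).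
  rewrite -(BI i Hi) rmorphM /= prednK // in E1.
  have E2 := eval_qint z i.
  rewrite rmorphM /= eval_atXn rmorphXn /=.
  apply: (mulIf (expf_neq0 2 d0)).
  rewrite -[RHS]mulrA -[_ / _ * _]mulrA mulVf ?expf_neq0 // mulr1.
  (* By [eval_qbinom_pred], the part [i.-1 * i] of the exponent cancels the square of
     [binom(p-1, i-1)], leaving [z ^+ i]. *)
  have -> : (i ^ 2 = i + i.-1 * i)%N by case: (i) i0 => // n _; rewrite /=; ring.
  have -> : (1 - z ^+ i) ^+ 2 = (z ^+ i - 1) ^+ 2 by ring.
  rewrite exprD -E2; transitivity ((1 - z) ^+ 2 * z ^+ i * 1); last by ring.
  by rewrite -E1; ring.
have := sum_prim_inverse_square pz; set s := \sum_(1 <= i < p) _ => sE.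
have t0 : 12 != 0 :> algC by rewrite pnatr_eq0.
apply: (mulfI t0).
have N12 : 12 * N%:R = p%:R ^+ 2 - 1 :> algC.
  by rewrite -natrM NE natrB ?natrX // expn_gt0 p_gt0.
transitivity ((1 - z) ^+ 2 * (12 * s) + (12 * N%:R) * (z - 1) ^+ 2); first by ring.
by rewrite sE N12; ring.
Qed.

(** * Congruences modulo [[p]], [[p]^2] and [[p]^3] by induction on [a] *)

Lemma qbinom_block a k :
  qbinom (a.+1 * p) k =
    qbinom (a * p) k
    + (if (p <= k)%N then 'X^(p * (a * p + p - k)) * qbinom (a * p) (k - p) else 0)
    + \sum_(1 <= j < p | (j <= k)%N)
        'X^(j * (a * p + j - k)) * qbinom (a * p) (k - j) * qbinom p j.
Proof.
have p_gt0 := prime_gt0 p_prime.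
rewrite mulSn addnC qVandermonde big_mkcond big_ltn // big_nat_recr //=.
rewrite mul0n expr0 subn0 qbinomn0 mul1r mulr1 qbinomnn mulr1 -big_mkcond.
by rewrite -addrA; congr (_ + _); rewrite addrC.
Qed.

(** Modulo [[p]], powers of [q^p] become 1 and the inner terms of [qbinom_block] vanish, which
    leaves the ordinary Pascal rule. *)
Lemma qbinom_mod1 a b : qdvd p 1 (qbinom (a * p) (b * p) - 'C(a, b)%:R).
Proof.
have p_gt0 := prime_gt0 p_prime.
elim: a b => [|a IHa] [|b].
- by rewrite qbinomn0 bin0 subrr; apply: qdvd0.
- by rewrite qbinom_small ?muln_gt0 //= subrr; apply: qdvd0.
- by rewrite qbinomn0 bin0 subrr; apply: qdvd0.
rewrite qbinom_block leq_pmull // binS natrD.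
set s := \sum_(_ <= _ < _ | _) _.
have -> : (b.+1 * p - p = b * p)%N by rewrite mulSn addKn.
set X1 := 'X^ _.
have -> : qbinom (a * p) (b.+1 * p) + X1 * qbinom (a * p) (b * p) + s
  - ('C(a, b.+1)%:R + 'C(a, b)%:R)
  = (qbinom (a * p) (b.+1 * p) - 'C(a, b.+1)%:R)
   + (qbinom (a * p) (b * p) - 'C(a, b)%:R)
   + (X1 - 1) * qbinom (a * p) (b * p) + s by ring.
apply: qdvdD; first apply: qdvdD; first apply: qdvdD => //.
  exact/qdvdMr/qdvd_Xpm.
rewrite /s big_nat_cond; apply: qdvd_sum => j /andP[Hj _].
exact/qdvdMl/qdvd_qbinom.
Qed.

(** Of the inner terms of [qbinom_block] only [j = k] survives modulo [[p]^2]. It already contains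
    [binom(p, k)], so its other factor matters only modulo [[p]] and becomes [C(a, b)] by
    [qbinom_mod1]. *)
Lemma qbinom_mod2 a b k : (0 < k < p)%N ->
  qdvd p 2 (qbinom (a * p) (b * p + k) - (b.+1 * 'C(a, b.+1))%:R * qbinom p k).
Proof.
move=> Hk; case/andP: (Hk) => k_gt0 lt_kp.
have p_gt0 := prime_gt0 p_prime.
elim: a b => [|a IHa] b.
  rewrite qbinom_small ?addn_gt0 ?k_gt0 ?orbT // bin0n muln0 mul0r subrr.
  exact: qdvd0.
rewrite qbinom_block.
set s := \sum_(_ <= _ < _ | _) _.
have sE : qdvd p 2 (s - 'C(a, b)%:R * qbinom p k).
  rewrite /s big_mkcond (bigD1_seq k) ?mem_index_iota ?iota_uniq //= leq_addl.
  rewrite addnK addrAC; apply: qdvdD.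
    rewrite -mulrBl; apply: (@qdvdM p 1 1); last exact: qdvd_qbinom.
    set e := (k * _)%N.
    have [le_ba|lt_ab] := leqP b a; last first.
      rewrite qbinom_small ?ltn_pmul2r // bin_small // mulr0 subrr; exact: qdvd0.
    have -> : e = (p * (k * (a - b)))%N.
      rewrite /e addnC [(b * p + k)%N]addnC subnDl -mulnBl; ring.
    have := qbinom_mod1 a b; set u := qbinom _ _ => Hu.
    set X1 := 'X^ _.
    have -> : X1 * u - 'C(a, b)%:R = (X1 - 1) * u + (u - 'C(a, b)%:R) by ring.
    by apply: qdvdD => //; apply/qdvdMr/qdvd_Xpm.
  rewrite big_nat_cond; apply: qdvd_sum => j /andP[/andP[j_gt0 lt_jp] neq_jk].
  case: ifP => le_j; last exact: qdvd0.
  apply: (@qdvdM p 1 1); last by apply: qdvd_qbinom; rewrite j_gt0.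
  (* If [p] divided [b * p + k - j], then [j] and [k], both below [p], would coincide. *)
  apply/qdvdMl/qdvd_qbinom_mul; apply: contra neq_jk => dv.
  have : (b * p + k == j %[mod p])%N by rewrite eqn_mod_dvd.
  by rewrite modnMDl !modn_small // eq_sym.
(* For [b = 0] the term [j = p] is absent because [k < p]; [s] alone raises the coefficient from [a]
   to [a + 1]. *)
case: b s sE => [|b] s sE.
  rewrite add0n leqNgt lt_kp /= addr0.
  have := IHa 0%N; rewrite bin0 in sE *; rewrite !bin1 !mul1n mul0n add0n => H.
  rewrite -natr1.
  have -> : qbinom (a * p) k + s - (a%:R + 1) * qbinom p k =
   (qbinom (a * p) k - a%:R * qbinom p k) + (s - 1 * qbinom p k) by ring.
  exact: qdvdD.
have -> : (p <= b.+1 * p + k)%N by rewrite mulSn -addnA leq_addr.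
have -> : (b.+1 * p + k - p = b * p + k)%N by rewrite mulSn -addnA addKn.
set X1 := 'X^ _; set u := qbinom _ _; set v := qbinom _ (b * p + k).
have Hu := IHa b.+1; have Hv := IHa b; rewrite -/u in Hu; rewrite -/v in Hv.
have -> : u + X1 * v + s - (b.+2 * 'C(a.+1, b.+2))%:R * qbinom p k =
  (u - (b.+2 * 'C(a, b.+2))%:R * qbinom p k)
  + (v - (b.+1 * 'C(a, b.+1))%:R * qbinom p k)
  + (s - 'C(a, b.+1)%:R * qbinom p k) + (X1 - 1) * v.
  by rewrite binS !natrM natrD -[b.+2%:R]natr1; ring.
apply: qdvdD; first apply: qdvdD => //; first exact: qdvdD.
apply: (@qdvdM p 1 1); first exact: qdvd_Xpm.
apply: qdvd_qbinom_mul; rewrite dvdn_addr ?dvdn_mull //.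
by rewrite gtnNdvd.
Qed.

Lemma qbinom_mod3 N a b : (12 * N)%N = (p ^ 2 - 1)%N ->
  qdvd p 3 (qbinom (a * p) (b * p)
      - (qbinom a b \Po 'X^(p ^ 2)
         - ('C(a, b.+1) * 'C(b.+1, 2) * N)%:R * ('X^p - 1) ^+ 2)).
Proof.
move=> NE; have p_gt0 := prime_gt0 p_prime.
elim: a b => [|a IHa] [|b].
- rewrite !qbinomn0 comp_polyC bin0n !mul0n mul0r subr0 subrr; exact: qdvd0.
- rewrite !qbinom_small ?muln_gt0 // bin0n !mul0n mul0r comp_poly0 !subrr.
  exact: qdvd0.
- rewrite !qbinomn0 comp_polyC [in 'C(1, 2)]bin_small // muln0 !mul0n mul0r.
  rewrite subr0 subrr; exact: qdvd0.
rewrite qbinom_block leq_pmull //.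
have -> : (b.+1 * p - p = b * p)%N by rewrite mulSn addKn.
(* This is the exponent of the q-Pascal rule for [qbinom a.+1 b.+1] after substituting [q^(p^2)]. *)
have -> : (p * (a * p + p - b.+1 * p) = p ^ 2 * (a - b))%N.
  by rewrite addnC -mulSn -mulnBl subSS; ring.
rewrite qbinomS comp_polyD comp_polyM comp_Xn_poly -exprM.
set s := \sum_(_ <= _ < _ | _) _.
pose S := \sum_(1 <= i < p) 'X^(i ^ 2) * qbinom p i ^+ 2 : {poly int}.
(* [qbinom_mod2] is applied with [k = p - j], and symmetry turns [binom(p, p-j)] into the second
   factor of the square. *)
have sE : qdvd p 3 (s - (b.+1 * 'C(a, b.+1))%:R * S).
  rewrite /s /S mulr_sumr big_nat_cond [X in _ - X]big_nat_cond.
  rewrite (eq_bigl (fun i => (1 <= i < p)%N && true)); last first.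
    move=> j /=; case: (boolP (1 <= j < p)%N) => //= /andP[_ lt_jp].
    by rewrite mulSn (leq_trans (ltnW lt_jp)) ?leq_addr.
  rewrite -sumrB; apply: qdvd_sum => j; rewrite andbT => Hj.
  case/andP: (Hj) => j_gt0 lt_jp.
  have -> : (b.+1 * p - j = b * p + (p - j))%N by rewrite mulSn; lia.
  have := @qbinom_mod2 a b (p - j); set u := qbinom _ (_ + _).
  rewrite (qbinom_sub (ltnW lt_jp)) => Hu.
  have {}Hu : qdvd p 2 (u - (b.+1 * 'C(a, b.+1))%:R * qbinom p j).
    by apply: Hu; lia.
  (* For [a <= b] truncated subtraction spoils the exponent identity below, but then [u] and
     ['C(a, b.+1)] are both zero. *)
  have [le_ab|lt_ba] := leqP a b.
    rewrite /u qbinom_small; last first.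
      by rewrite -[X in (X < _)%N]addn0 -addnS leq_add ?leq_pmul2r // subn_gt0.
    rewrite bin_small // muln0 mulr0 !mul0r subrr; exact: qdvd0.
  have -> : (j * (a * p + j - b.+1 * p) = p * (j * (a - b.+1)) + j ^ 2)%N.
    rewrite addnC -addnBA ?leq_pmul2r // -mulnBl; ring.
  rewrite exprD; set X1 := 'X^(p * _); set c := _%:R.
  have -> : X1 * 'X^(j ^ 2) * u * qbinom p j - c * ('X^(j ^ 2) * qbinom p j ^+ 2)
   = ('X^(j ^ 2) * qbinom p j) * (u - c * qbinom p j)
     + 'X^(j ^ 2) * ((X1 - 1) * (u * qbinom p j)) by ring.
  apply: qdvdD.
    by apply: (@qdvdM p 1 2) => //; apply/qdvdMl/qdvd_qbinom.
  apply/qdvdMl/(@qdvdM p 1 2); first exact: qdvd_Xpm.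
  apply/(@qdvdM p 1 1); last exact: qdvd_qbinom.
  apply: qdvd_qbinom_mul; rewrite dvdn_addr ?dvdn_mull // gtnNdvd //; lia.
have SE := qdvd_sum_sqr_qbinom NE; rewrite -/S in SE.
have Hu := IHa b.+1; have Hv := IHa b.
move: Hu Hv; set u := qbinom _ _; set v := qbinom _ (b * p) => Hu Hv.
set X1 := 'X^(_ * _); set c := (_ \Po _) in Hu *; set d := (_ \Po _) in Hv *.
set y := ('X^p - 1) ^+ 2 in Hu Hv SE *.
(* The coefficients match because [C(b+2, 2) = C(b+1, 2) + (b+1)]. The last term replaces [X1 * y]
   by [y], at the cost of a multiple of [[p]^3]. *)
have -> : u + X1 * v + s - (c + X1 * d - ('C(a.+1, b.+2) * 'C(b.+2, 2) * N)%:R * y)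
  = (u - (c - ('C(a, b.+2) * 'C(b.+2, 2) * N)%:R * y))
   + X1 * (v - (d - ('C(a, b.+1) * 'C(b.+1, 2) * N)%:R * y))
   + (s - (b.+1 * 'C(a, b.+1))%:R * S)
   + (b.+1 * 'C(a, b.+1))%:R * (S + N%:R * y)
   - (X1 - 1) * y * ('C(a, b.+1) * 'C(b.+1, 2) * N)%:R.
  rewrite [in 'C(a.+1, _)]binS [in 'C(b.+2, 2)]binS bin1.
  by rewrite !(natrM, natrD); ring.
apply: qdvdD; first apply: qdvdD; first apply: qdvdD => //; first apply: qdvdD => //.
- exact: qdvdMl.
- exact: qdvdMl.
apply/qdvdN/qdvdMr/(@qdvdM p 1 2).
  by rewrite /X1 expnS expn1 -mulnA; apply: qdvd_Xpm.
by apply: (@qdvdM p 1 1); apply: qdvd_Xp.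
Qed.

End RootOfUnity.

(** * Integrality of [(p^2 - 1) / 12] and conclusion *)

(** Modulo 12, [p] is prime to 2 and 3, hence one of 1, 5, 7, 11, all of which square to 1. *)
Lemma dvd12_prime_sqr p : prime p -> (5 <= p)%N -> (12 %| p ^ 2 - 1)%N.
Proof.
move=> p_prime p_ge5.
have n2 : (p %% 2 != 0)%N.
  by rewrite -/(dvdn 2 p) dvdn_prime2 //; lia.
have n3 : (p %% 3 != 0)%N.
  by rewrite -/(dvdn 3 p) dvdn_prime2 //; lia.
rewrite -eqn_mod_dvd ?expn_gt0 ?prime_gt0 // -modnXm.
have : (p %% 12 < 12)%N by rewrite ltn_mod.
have : ((p %% 12) %% 2 != 0)%N by rewrite modn_dvdm.
have : ((p %% 12) %% 3 != 0)%N by rewrite modn_dvdm.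
by case: (p %% 12)%N; do 12?[case=> //].
Qed.

Theorem theorem1 (p a b : nat) (p_prime : prime p) (p_ge5 : (5 <= p)%N) :
  exists h : {poly int},
    qbinom (a * p) (b * p)
      - (qbinom a b \Po 'X^(p ^ 2)
         - ('C(a, b.+1) * 'C(b.+1, 2) * ((p ^ 2 - 1) %/ 12))%:R
             * ('X^p - 1) ^+ 2)
    = qint p ^+ 3 * h.
Proof.
by apply: qbinom_mod3; rewrite // mulnC divnK ?dvd12_prime_sqr.
Qed.
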